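(* Let $G$ be a non-trivial finite nilpotent group. Then $G$ is a $\mathcal{B}_{\psi}$-group if and only if there is a prime $p$ such that $G\cong C_{p^2}$ or $\exp(G)=p$.
   Context: For a finite group $H$, let $\psi(H)=\sum_{x\in H}o(x)$ be the sum of the orders of all elements of $H$, where $o(x)$ is the order of $x$. A finite group $G$ is called a $\mathcal{B}_{\psi}$-group if $\psi(H)<|G|$ for every proper subgroup $H$ of $G$. $C_n$ denotes the cyclic group of order $n$ and $\exp(G)$ the exponent of $G$. *)

(* Defs.v *)
From mathcomp Require Import all_boot all_order all_algebra all_fingroup all_solvable.

Set Implicit Arguments.
Unset Strict Implicit.
Unset Printing Implicit Defensive.

Local Open Scope group_scope.

Definition psi (gT : finGroupType) (H : {set gT}) : nat :=
  (\sum_(x in H) #[x])%N.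

Definition Bpsi_group (gT : finGroupType) (G : {group gT}) : Prop :=
  forall H : {group gT}, H \proper G -> psi H < #|G|.

(* Main.v *)
(** Proper subgroups of index at most the typical element order have [psi] too
    large.  If the order of [G] has several prime divisors, let [p] be the
    largest: a subgroup [H] of prime index [r < p] containing the Sylow
    [p]-subgroup has all but at most [#|H| / p] elements of order at least [p],
    hence [psi H >= (p - 1) #|H| >= #|G|].  If [G] is a [p]-group with an element
    [x] of order [p ^ 2] and [<[x]>] is proper, then a maximal subgroup [M]
    containing [x] has [psi M >= 1 + p ^ 2 + p (#|M| - 2) >= p #|M| = #|G|].
    Conversely, in both families the elements of a proper subgroup [H] have
    order at most [p], so [psi H < p #|H| <= #|G|]. *)

Require Import Defs.
From mathcomp Require Import all_boot all_order all_algebra all_fingroup all_solvable.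
From mathcomp Require Import zify.

Local Open Scope group_scope.

(** The inequality is strict because the identity contributes only 1, less than the [p] allotted to
    each element. *)
Lemma psi_lt_mul (gT : finGroupType) (H : {group gT}) (p : nat) :
  (1 < p)%N -> {in H, forall x, #[x] <= p} -> psi H < (p * #|H|)%N.
Proof.
move=> p_gt1 leHp; rewrite /psi (big_setD1 1) //= order1.
have le_rest: (\sum_(x in H :\ 1%g) #[x] <= #|H :\ 1%g| * p)%N.
  by rewrite -sum_nat_const; apply: leq_sum => x /setD1P[_ /leHp].
by rewrite (cardsD1 1 H) group1 mulnDr muln1 mulnC; apply: (@leq_add 2).
Qed.

Lemma pgroup_order_ge (gT : finGroupType) (H : {group gT}) (p : nat) (x : gT) :
  p.-group H -> x \in H -> x != 1 -> p <= #[x].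
Proof.
move=> pH Hx ntx; rewrite -cycle_eq1 in ntx.
have [_ p_x _] := pgroup_pdiv (mem_p_elt pH Hx) ntx.
exact: dvdn_leq (order_gt0 x) p_x.
Qed.

(** The large order of [x] makes up for the small order of the identity: together they contribute
    [1 + p ^ 2], at least [2 * p] since [(p - 1) ^ 2] is nonnegative. *)
Lemma pgroup_psi_ge (gT : finGroupType) (M : {group gT}) (p : nat) (x : gT) :
  p.-group M -> x \in M -> #[x] = (p ^ 2)%N -> x != 1 -> (p * #|M| <= psi M)%N.
Proof.
move=> pM Mx ox ntx; have M1x: x \in M :\ 1 by rewrite !inE ntx.
rewrite /psi (big_setD1 1) //= (big_setD1 x) //= order1 ox.
have le_rest: (#|M :\ 1%g :\ x| * p <= \sum_(y in M :\ 1%g :\ x) #[y])%N.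
  rewrite -sum_nat_const; apply: leq_sum => y /setD1P[_ /setD1P[nty My]].
  exact: pgroup_order_ge pM My nty.
rewrite (cardsD1 1 M) group1 (cardsD1 x (M :\ 1)) M1x !addnA mulnDr.
by rewrite [X in _ + X <= _]mulnC; apply: leq_add le_rest; nia.
Qed.

(** By nilpotency the normal Hall subgroup [K] contains every element of order prime to [p], so each
    element outside [K] has order at least [p]; the index of [K] is the [p]-part of [#|H|], hence at
    least [p]. *)
Lemma nilpotent_psi_ge (gT : finGroupType) (H : {group gT}) (p : nat) :
  nilpotent H -> prime p -> p %| #|H| -> (p.-1 * #|H| <= psi H)%N.
Proof.
move=> nilH p_pr p_H; set K := 'O_p^'(H)%G.
have hallK: p^'.-Hall(H) K := nilpotent_pcore_Hall _ nilH.
have sKH: K \subset H := pcore_sub _ _.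
have cardH: #|H| = (#|K| * #|H|`_p)%N.
  by rewrite (card_Hall hallK) mulnC partnC ?cardG_gt0.
have le_pH: p <= #|H|`_p.
  by rewrite -{1}(part_pnat_id (pnat_id p_pr)) dvdn_leq ?part_gt0 ?partn_dvd.
rewrite /psi (big_setID K) /= (setIidPr sKH).
have leD: (#|H :\: K| * p <= \sum_(x in H :\: K) #[x])%N.
  rewrite -sum_nat_const; apply: leq_sum => x /setDP[Hx notKx].
  rewrite dvdn_leq ?order_gt0 //; apply: contraR notKx => p'x.
  by rewrite (mem_normal_Hall hallK (pcore_normal _ _)) // /p_elt p'natE.
have leK: #|K| <= \sum_(x in K) #[x].
  by rewrite -sum1_card; apply: leq_sum => x _; apply: order_gt0.
apply: leq_trans (leq_add leK leD).
rewrite cardsD (setIidPr sKH).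
have lepK: (#|K| * p <= #|H|)%N by rewrite cardH leq_mul.
have arith (k h : nat) : (k * p <= h -> p.-1 * h <= k + (h - k) * p)%N.
  by rewrite -subn1 !mulnBl mul1n; lia.
exact: arith lepK.
Qed.

Lemma nilpotent_Bpsi_pgroup (gT : finGroupType) (G : {group gT}) :
  nilpotent G -> Bpsi_group G -> (max_pdiv #|G|).-group G.
Proof.
move=> nilG BG; set p := max_pdiv _.
(* For trivial [G], [max_pdiv] takes its default value 1, which is not prime. *)
have [-> | ntG] := eqsVneq G 1%G; first exact: pgroup1.
have p_pr: prime p by rewrite max_pdiv_prime ?cardG_gt1.
have p_G: p %| #|G| := max_pdiv_dvd _.
have sylP: p.-Sylow(G) 'O_p(G) := nilpotent_pcore_Hall _ nilG.
have nsPG: 'O_p(G) <| G := pcore_normal _ _.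
apply: contraT => p'G.
have ntGP: (G / 'O_p(G))%G :!=: 1.
  apply: contra p'G => /eqP/trivgP; rewrite quotient_sub1 ?normal_norm // => sGP.
  exact: pgroupS sGP (pcore_pgroup _ _).
have solGP := nilpotent_sol (quotient_nil 'O_p(G) nilG).
(* A nontrivial solvable group has a normal subgroup of prime index; its preimage [H] in [G]
   contains the Sylow subgroup ['O_p(G)]. *)
have [Hb nsHb pr_r] := sol_prime_factor_exists solGP ntGP.
have [H defHb sPH nsHG] := inv_quotientN nsPG nsHb.
have iHG: #|G / 'O_p(G) : Hb| = #|G : H|.
  by rewrite defHb index_quotient_eq ?normal_norm ?(normal_sub nsHG) ?(subset_trans (subsetIr _ _) sPH).
rewrite iHG in pr_r.
have sHG := normal_sub nsHG.
have r_GP: #|G : H| %| #|G : 'O_p(G)|.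
  by rewrite -(Lagrange_index sHG sPH) dvdn_mulr.
(* The index of [H] divides that of the Sylow [p]-subgroup, which is prime to [p]. *)
have p'r: #|G : H| != p.
  have /andP[_ /andP[_ p'i]] := sylP.
  apply: contraTneq r_GP => ->; by rewrite -p'natE.
have le_rp: #|G : H| <= p.
  by rewrite max_pdiv_max // mem_primes pr_r cardG_gt0 dvdn_indexg.
have p_H: p %| #|H|.
  apply: dvdn_trans (cardSg sPH).
  by rewrite (card_Hall sylP) -{1}(part_pnat_id (pnat_id p_pr)) partn_dvd.
have ltHG: H \proper G.
  by rewrite properEneq sHG andbT; apply: contraTneq pr_r => ->; rewrite indexgg.
have le_rp1: #|G : H| <= p.-1.
  by rewrite -ltnS prednK ?prime_gt0 // ltn_neqAle p'r.
have le_psi := nilpotent_psi_ge _ _ _ (nilpotentS sHG nilG) p_pr p_H.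
have := leq_trans (BG H ltHG) (leq_trans _ le_psi).
by rewrite ltnn -(Lagrange sHG) mulnC leq_mul // => /(_ isT).
Qed.

Lemma pgroup_order_p2_exists (gT : finGroupType) (G : {group gT}) (p : nat) :
  prime p -> p.-group G -> G :!=: 1 -> exponent G != p ->
  exists2 x, x \in G & #[x] = (p ^ 2)%N.
Proof.
move=> p_pr pG ntG neqGp.
have [y Gy oy] := exponent_witness (pgroup_nil pG).
have [n oyn] := p_natP (mem_p_elt pG Gy).
(* The order of [y] is the exponent of [G]: [n = 0] would make [G] trivial, and [n = 1] would give
   exponent [p]. *)
have n_gt1: (1 < n)%N.
  case: n oyn oy => [|[|n]] // -> oy; last by rewrite oy eqxx in neqGp.
  by rewrite trivg_exponent oy dvdn1 in ntG.
exists (y ^+ (p ^ (n - 2))%N); first exact: groupX.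
by rewrite (orderXexp _ oyn) subKn.
Qed.

Lemma cyclic_p2_order_le (gT : finGroupType) (G H : {group gT}) (p : nat) :
  prime p -> #|G| = (p ^ 2)%N -> H \proper G -> {in H, forall x, #[x] <= p}.
Proof.
move=> p_pr oG /andP[sHG /negbTE notGH] x Hx.
apply: leq_trans (dvdn_leq (cardG_gt0 H) (order_dvdG Hx)) _.
have /(dvdn_pfactor _ _ p_pr)[[|[|[|m]]] // _ oH] : #|H| %| (p ^ 2)%N.
- by rewrite -oG cardSg.
- by rewrite oH prime_gt0.
- by rewrite oH.
- suff: G \subset H by rewrite notGH.
  by have /eqP-> : H :==: G by rewrite eqEcard sHG oG oH leqnn.
Qed.

Theorem theorem2p5 (gT : finGroupType) (G : {group gT})
    (ntG : G :!=: 1) (nilG : nilpotent G) :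
  Bpsi_group G <->
  exists p : nat, prime p /\ (G \isog Zp (p ^ 2)%N \/ exponent G = p).
Proof.
split=> [BG | [p [p_pr caseG]] H ltHG].
  have := nilpotent_Bpsi_pgroup _ _ nilG BG; set p := max_pdiv _ => pG.
  have p_pr: prime p by rewrite max_pdiv_prime ?cardG_gt1.
  exists p; split=> //; have [|neqGp] := eqVneq (exponent G) p; [by right | left].
  have [x Gx ox] := pgroup_order_p2_exists _ _ _ p_pr pG ntG neqGp.
  have ntx: x != 1.
    rewrite -order_gt1 ox.
    exact: leq_trans (prime_gt1 p_pr) (leq_pmulr _ (prime_gt0 p_pr)).
  have sxG: <[x]> \subset G by rewrite cycle_subG.
  (* Either [x] generates [G], which is then cyclic of order [p ^ 2], or a maximal subgroup
     containing [x], of index [p], violates the bound. *)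
  have [defG | [M maxM sxM]] := maximal_exists sxG.
    by rewrite -defG isog_sym -ox Zp_isog.
  have sMG := maxgroupp maxM; have sMG' := proper_sub sMG.
  have Mx: x \in M by rewrite -cycle_subG.
  have := pgroup_psi_ge _ _ _ _ (pgroupS sMG' pG) Mx ox ntx.
  have := BG M sMG; rewrite -(Lagrange sMG') (p_maximal_index pG maxM).
  by rewrite mulnC ltnNge => /negbTE->.
have [pG leHp]: p.-group G /\ {in H, forall x, #[x] <= p}.
  case: caseG => [/card_isog | expG].
    rewrite card_Zp ?expn_gt0 ?prime_gt0 // => oG.
    by split; [rewrite /pgroup oG pnatX pnat_id | apply: cyclic_p2_order_le oG ltHG].
  split=> [|x Hx]; first by rewrite -pnat_exponent expG pnat_id.
  rewrite dvdn_leq ?prime_gt0 // -expG dvdn_exponent //.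
  exact: subsetP (proper_sub ltHG) x Hx.
apply: leq_trans (psi_lt_mul _ _ _ (prime_gt1 p_pr) leHp) _.
have sHG := proper_sub ltHG; rewrite -(Lagrange sHG) mulnC leq_mul //.
(* The index of [H] is a power of [p], and not 1 since [H] is proper, so it is at least [p]. *)
have [n iHG] := p_natP (pnat_dvd (dvdn_indexg G H) pG).
case: n iHG => [iHG | n ->]; last by rewrite expnS leq_pmulr ?expn_gt0 ?prime_gt0.
by rewrite properE sHG -indexg_eq1 iHG eqxx in ltHG.
Qed.
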